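(* Let $S:\mathbb{R}^n\rightrightarrows\mathbb{R}^n$ be a set-valued operator, $X\subseteq\mathbb{R}^n$ a closed linear subspace, $\gamma,\lambda_x,\lambda_y>0$, $x^0\in X$, $y^0\in X^\perp$, and set $z^0=x^0+y^0$. Let $(q^k,x^k,y^k)_{k\in\mathbb{N}}$ be any sequence generated, starting from $(x^0,y^0)$, by the progressive decoupling+ iteration $$q^k\in J_{\gamma^{-1}S}(x^k+\gamma^{-1}y^k),\qquad x^{k+1}=(1-\lambda_x)x^k+\lambda_x\Pi_X(q^k),\qquad y^{k+1}=y^k-\lambda_y\gamma\,\Pi_{X^\perp}(q^k).$$ Then the sequence $$(z^k,\bar z^k)_{k\in\mathbb{N}}=\bigl(x^k+y^k,\ \Pi_X(q^k)+y^k-\gamma\,\Pi_{X^\perp}(q^k)\bigr)_{k\in\mathbb{N}}$$ is a sequence generated by the relaxed preconditioned proximal point algorithm applied to $0\in S^X(z)$, initialized at $z^0$, with $P=\gamma\Pi_X+\gamma^{-1}\Pi_{X^\perp}$ and $\Lambda=\lambda_x\Pi_X+\lambda_y\Pi_{X^\perp}$; that is, for all $k\in\mathbb{N}$, $$\bar z^k\in(P+S^X)^{-1}Pz^k,\qquad z^{k+1}=z^k+\Lambda(\bar z^k-z^k).$$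
   Context: $\Pi_X$ and $\Pi_{X^\perp}$ are the orthogonal projections onto $X$ and its orthogonal complement $X^\perp$. For a set-valued operator $A$, $\mathrm{gph}\,A=\{(x,y): y\in A(x)\}$, $A^{-1}$ is defined by $\mathrm{gph}\,A^{-1}=\{(y,x):(x,y)\in\mathrm{gph}\,A\}$, and $J_A=(\mathrm{id}+A)^{-1}$ is the resolvent. The partial inverse $S^X:\mathbb{R}^n\rightrightarrows\mathbb{R}^n$ of $S$ with respect to $X$ is defined by $\mathrm{gph}\,S^X=L_X(\mathrm{gph}\,S)$, where $L_X(x,y)=\bigl(\Pi_X(x)+\Pi_{X^\perp}(y),\ \Pi_X(y)+\Pi_{X^\perp}(x)\bigr)$. *)

(* Defs.v *)
From HB Require Import structures.
From mathcomp Require Import all_boot all_order all_algebra.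
From mathcomp Require Import classical_sets reals.

Set Implicit Arguments.
Unset Strict Implicit.
Unset Printing Implicit Defensive.

Import Order.TTheory GRing.Theory Num.Theory.
Local Open Scope classical_set_scope.
Local Open Scope ring_scope.

Section Euclidean.
Context {R : realType} {n : nat}.
Implicit Types (u v : 'rV[R]_n) (X : {vspace 'rV[R]_n}).

Definition dotv u v : R := \sum_(i < n) u 0 i * v 0 i.

Fact dotv_is_bilinear :
  bilinear_for (GRing.Scale.Law.clone _ _ *%R _)
               (GRing.Scale.Law.clone _ _ (idfun \; *%R) _) dotv.
Proof.
split=> [w a u v|w a u v] /=; rewrite /dotv mulr_sumr -big_split /=;
  apply: eq_bigr => i _; rewrite !mxE.
  by rewrite mulrDl mulrA.
by rewrite mulrDr mulrCA.
Qed.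

HB.instance Definition _ := bilinear_isBilinear.Build R
  'rV[R]_n 'rV[R]_n R (GRing.Scale.Law.clone _ _ *%R _)
  (GRing.Scale.Law.clone _ _ (idfun \; *%R) _) dotv dotv_is_bilinear.

Fact dotv_is_hermitian u v :
  dotv u v = (-1) ^+ false * idfun (dotv v u).
Proof.
by rewrite mul1r /dotv /=; apply: eq_bigr => i _; rewrite mulrC.
Qed.

HB.instance Definition _ := isHermitianSesquilinear.Build
  R 'rV[R]_n false idfun dotv dotv_is_hermitian.

Fact dotv_gt0 u : u != 0 -> 0 < dotv u u.
Proof.
move=> u0; rewrite lt_neqAle sumr_ge0 ?andbT; last first.
  by move=> i _; rewrite -expr2 sqr_ge0.
apply: contraNneq u0 => /esym/eqP.
rewrite psumr_eq0 => [/allP h|i _]; last by rewrite -expr2 sqr_ge0.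
apply/eqP/rowP => i; rewrite mxE; apply/eqP.
by have /= := h i (mem_index_enum i); rewrite mulf_eq0 orbb.
Qed.

HB.instance Definition _ := isDotProduct.Build R 'rV[R]_n dotv dotv_gt0.

(* Every linear subspace of R^n is closed, so a closed linear subspace is
   exactly a {vspace 'rV[R]_n}. *)
Definition orth_compl X : {vspace 'rV[R]_n} := orthov dotv X.

(* Projection onto X along its orthogonal complement; daddv_pi is meaningful
   only because the two subspaces are complementary, cf. orth_projP. *)
Definition orth_proj X : 'End('rV[R]_n) := daddv_pi X (orth_compl X).

Lemma orth_complP X u :
  reflect {in X, forall v, dotv u v = 0} (u \in orth_compl X).
Proof. exact: mem_orthovP. Qed.

Lemma cap_orth_compl X : (X :&: orth_compl X)%VS = 0%VS.
Proof.
apply/eqP; rewrite -subv0; apply/subvP => u; rewrite memv_cap memv0.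
case/andP=> uX /orth_complP/(_ u uX) uu0; apply: contra_eqT uu0 => u0.
by rewrite gt_eqF // dotv_gt0.
Qed.

Lemma add_orth_compl X : (X + orth_compl X)%VS = fullv.
Proof.
pose f u : 'rV[R]_(\dim X) := \row_i dotv u (vbasis X)`_i.
have lf : linear f.
  move=> a u v; apply/rowP => i; rewrite !mxE /dotv mulr_sumr -big_split /=.
  by apply: eq_bigr => j _; rewrite !mxE mulrDl mulrA.
pose hf := GRing.isLinear.Build _ _ _ _ f lf.
pose F : {linear 'rV[R]_n -> 'rV[R]_(\dim X)} := HB.pack f hf.
have kerF : (lker (linfun F) <= orth_compl X)%VS.
  apply/subvP => u; rewrite memv_ker lfunE /= => /eqP/rowP fu0.
  apply/orth_complP => v /coord_vbasis ->.
  rewrite /dotv; under eq_bigr do rewrite summxE mulr_sumr.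
  rewrite exchange_big big1 //= => j _.
  have e : dotv u (vbasis X)`_j = 0 by have := fu0 j; rewrite !mxE.
  transitivity (coord (vbasis X) j v * dotv u (vbasis X)`_j).
    rewrite /dotv mulr_sumr.
    by apply: eq_bigr => i _; rewrite mxE mulrCA.
  by rewrite e mulr0.
apply/eqP; rewrite eqEdim subvf dimv_disjoint_sum ?cap_orth_compl //=.
have := limg_ker_dim (linfun F) fullv; rewrite capfv => <-.
rewrite addnC leq_add ?dimvS //.
by apply: leq_trans (dimvS (subvf _)) _; rewrite dimvf /dim /= mul1n.
Qed.

Lemma orth_projP X u :
  orth_proj X u \in X /\ u - orth_proj X u \in orth_compl X.
Proof.
split; first exact: memv_pi.
have uF : u \in (X + orth_compl X)%VS by rewrite add_orth_compl memvf.
rewrite -{1}(daddv_pi_add (cap_orth_compl X) uF) addrAC subrr add0r.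
exact: memv_pi.
Qed.

End Euclidean.

Section Operators.
Context {R : realType} {n : nat}.
Local Notation V := 'rV[R]_n.

Definition operator : Type := V -> set V.

Implicit Types (A B S : operator) (G : set (V * V)).

Definition gph A : set (V * V) := [set p | A p.1 p.2].

Definition op_of_gph G : operator := fun x => [set y | G (x, y)].

Definition op_inv A : operator :=
  op_of_gph [set p | exists x y, gph A (x, y) /\ p = (y, x)].

Definition op_fun (f : V -> V) : operator := fun x => [set f x].

Definition op_add A B : operator :=
  fun x => [set a + b | a in A x & b in B x].

Definition op_scale (c : R) A : operator := fun x => [set c *: a | a in A x].

Definition resolvent A : operator := op_inv (op_add (op_fun idfun) A).

Definition partial_swap (X : {vspace V}) (p : V * V) : V * V :=
  let PX := orth_proj X in let PXo := orth_proj (orth_compl X) in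
  (PX p.1 + PXo p.2, PX p.2 + PXo p.1).

Definition partial_inverse (X : {vspace V}) S : operator :=
  op_of_gph (partial_swap X @` gph S).

Definition progressive_decoupling_plus S (X : {vspace V})
    (gamma lambda_x lambda_y : R) (x0 y0 : V) (q x y : nat -> V) : Prop :=
  [/\ x 0%N = x0, y 0%N = y0 &
  forall k : nat,
    [/\ resolvent (op_scale gamma^-1 S) (x k + gamma^-1 *: y k) (q k),
        x k.+1 = (1 - lambda_x) *: x k + lambda_x *: orth_proj X (q k) &
        y k.+1 = y k - (lambda_y * gamma) *: orth_proj (orth_compl X) (q k)]].

Definition relaxed_preconditioned_ppa (T : operator) (P Lambda : 'End(V))
    (z0 : V) (z zbar : nat -> V) : Prop :=
  z 0%N = z0 /\
  forall k : nat,
    op_inv (op_add (op_fun P) T) (P (z k)) (zbar k) /\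
    z k.+1 = z k + Lambda (zbar k - z k).

End Operators.

Arguments operator R n : clear implicits.

(* Main.v *)
(* Writing s := gamma (x - q) + y, which lies in S(q) by the resolvent step, one
   has (zbar, w) = L_X(q, s) for w := Pi_X s + Pi_{X^perp} q, and P zbar + w = P z
   because x stays in X and y in X^perp. *)

Require Import Defs.
From mathcomp Require Import all_boot all_order all_algebra.
From mathcomp Require Import classical_sets reals.
From mathcomp Require Import ring.

Local Open Scope ring_scope.
Import Order.TTheory GRing.Theory Num.Theory.

Section OrthogonalProjection.
Context {R : realType} {n : nat} {X : {vspace 'rV[R]_n}}.
Implicit Types u v : 'rV[R]_n.

(** The difference [orth_proj X (u + v) - u] lies in $X$; it is also [v] minus the residual of the
    projection, hence in $X^\perp$, and $X\cap X^\perp=0$. *)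
Lemma orth_proj_add {u v} :
  u \in X -> v \in orth_compl X -> orth_proj X (u + v) = u.
Proof.
move=> uX vXo; have [PX dXo] := orth_projP X (u + v).
apply/eqP; rewrite -subr_eq0 -memv0 -(cap_orth_compl X) memv_cap rpredB //=.
have -> : orth_proj X (u + v) - u = v - (u + v - orth_proj X (u + v)).
  by rewrite opprB addrCA opprD (addrC (- u)) addNKr.
exact: rpredB.
Qed.

(** Symmetry of the inner product. This lets [orth_proj_add] be applied to $X^\perp$ with the two
    summands exchanged. *)
Lemma sub_orth_compl2 : (X <= orth_compl (orth_compl X))%VS.
Proof.
apply/subvP => u uX; apply/orth_complP => v /orth_complP/(_ u uX).
by rewrite dotv_is_hermitian expr0 mul1r.
Qed.

End OrthogonalProjection.

Lemma orth_proj_compl_add {R : realType} {n : nat} {X : {vspace 'rV[R]_n}} {u v} :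
  u \in X -> v \in orth_compl X -> orth_proj (orth_compl X) (u + v) = v.
Proof.
by move=> uX vXo; rewrite addrC orth_proj_add // (subvP sub_orth_compl2).
Qed.

Lemma orth_proj_sum {R : realType} {n : nat} (X : {vspace 'rV[R]_n}) u :
  u = orth_proj X u + orth_proj (orth_compl X) u.
Proof.
have [PX dXo] := orth_projP X u.
rewrite -{3}(subrKC (orth_proj X u) u).
by rewrite (orth_proj_compl_add PX dXo) subrKC.
Qed.

Lemma resolventP {R : realType} {n : nat} {A : operator R n} {u v} :
  resolvent A u v <-> A v (u - v).
Proof.
split=> [[v' [u' [[_ -> [a Aa /= <-]] [-> ->]]]]|Avu].
  by rewrite addrC addKr.
exists v, u; split=> //; exists v => //.
by exists (u - v) => //; rewrite subrKC.
Qed.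

(** Each update combines the current iterate with a projection onto the same subspace, so membership
    propagates by induction. *)
Lemma progressive_decoupling_plus_mem {R : realType} {n : nat}
    {S : operator R n} {X gamma lambda_x lambda_y x0 y0 q x y} :
  progressive_decoupling_plus S X gamma lambda_x lambda_y x0 y0 q x y ->
  x0 \in X -> y0 \in orth_compl X ->
  forall k, x k \in X /\ y k \in orth_compl X.
Proof.
move=> [<- <- step] x0X y0X; elim=> [//|k [xX yX]].
have [_ -> ->] := step k; have [qX _] := orth_projP X (q k).
have [qXo _] := orth_projP (orth_compl X) (q k).
by split; [rewrite rpredD ?rpredZ|rewrite rpredB ?rpredZ].
Qed.

Theorem lemma2p4 (R : realType) (n : nat) (S : operator R n)
    (X : {vspace 'rV[R]_n}) (gamma lambda_x lambda_y : R)
    (gamma_gt0 : 0 < gamma) (lambda_x_gt0 : 0 < lambda_x)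
    (lambda_y_gt0 : 0 < lambda_y)
    (x0 y0 : 'rV[R]_n) (x0X : x0 \in X) (y0X : y0 \in orth_compl X)
    (q x y : nat -> 'rV[R]_n)
    (pd : progressive_decoupling_plus S X gamma lambda_x lambda_y x0 y0 q x y) :
  relaxed_preconditioned_ppa (partial_inverse X S)
    (gamma *: orth_proj X + gamma^-1 *: orth_proj (orth_compl X))
    (lambda_x *: orth_proj X + lambda_y *: orth_proj (orth_compl X))
    (x0 + y0)
    (fun k => x k + y k)
    (fun k => orth_proj X (q k) + y k
              - gamma *: orth_proj (orth_compl X) (q k)).
Proof.
have g0 : gamma != 0 by rewrite gt_eqF.
have xy_mem := progressive_decoupling_plus_mem pd x0X y0X.
case: pd => <- <- step; split=> // k.
have [xX yX] := xy_mem k; have [/resolventP [s Ss sE] -> ->] := step k.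
have [aX _] := orth_projP X (q k); have [bX _] := orth_projP (orth_compl X) (q k).
have := orth_proj_sum X (q k); move: aX bX.
set a := orth_proj X (q k); set b := orth_proj _ (q k) => aX bX qE.
have zbX : y k - gamma *: b \in orth_compl X by rewrite rpredB ?rpredZ.
have wX : gamma *: (x k - a) \in X by rewrite rpredZ ?rpredB.
(* Decomposition of [s] along $X\oplus X^\perp$; its $X^\perp$ part is exactly that of $\bar
   z^k$. *)
have {}sE : s = gamma *: (x k - a) + (y k - gamma *: b).
  apply: (scalerI (invr_neq0 g0)); rewrite sE qE.
  by apply/rowP => i; rewrite !mxE; field.
rewrite -[a + y k - _]addrA; split; last first.
  (* Splitting $\bar z^k-z^k$ along $X\oplus X^\perp$ makes $\Lambda$ act as $\lambda_x$ and
     $\lambda_y$ on the two parts. *)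
  have -> : a + (y k - gamma *: b) - (x k + y k) = (a - x k) - gamma *: b.
    by apply/rowP => i; rewrite !mxE; ring.
  have axX : a - x k \in X by rewrite rpredB.
  have gbX : - (gamma *: b) \in orth_compl X by rewrite rpredN rpredZ.
  rewrite add_lfunE !scale_lfunE (orth_proj_add axX gbX).
  rewrite (orth_proj_compl_add axX gbX).
  by apply/rowP => i; rewrite !mxE; ring.
exists (a + (y k - gamma *: b)).
eexists; split; last by [].
eexists; first by [].
(* The second component of $L_X(q^k,s)$: the $X$ part of [s] plus the $X^\perp$ part of $q^k$. *)
exists (gamma *: (x k - a) + b).
  exists (q k, s) => //; rewrite /partial_swap /= -/a -/b sE.
  by rewrite (orth_proj_add wX zbX) (orth_proj_compl_add wX zbX).
(* On $X$: $\gamma a+\gamma(x^k-a)=\gamma x^k$. On $X^\perp$: $\gamma^{-1}(y^k-\gamma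
   b)+b=\gamma^{-1}y^k$. *)
rewrite !add_lfunE !scale_lfunE (orth_proj_add xX yX) (orth_proj_add aX zbX).
rewrite (orth_proj_compl_add xX yX) (orth_proj_compl_add aX zbX).
by apply/rowP => i; rewrite !mxE; field.
Qed.
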